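(* The pair $(\{\mathrm{Cay}_k(x;y)\}_{k=0}^\infty,\{k!\}_{k=0}^\infty)$ is a palindromic pair with degree $d(n)=n$.
   Context: Palindromic pairs. Let $\{p_k(x;y)\}_{k=0}^\infty$ be a sequence of polynomials in two variables with $p_0(x;y)=1$, $\{a_k\}_{k=0}^\infty$ a sequence of non-zero numbers, and $d\colon\mathbb{Z}_{\ge0}\to\mathbb{R}$ a map. For $n\in\mathbb{Z}_{\ge0}$ put $\mathscr{S}_k(p;n)=\{s\in\mathbb{C}:p_k(s;n)=0\}$. The pair $(\{p_k\},\{a_k\})$ is a palindromic pair with degree $d(n)$ if, for each $n\in\mathbb{Z}_{\ge 0}$ with $d(n)\in\mathbb{Z}_{\ge0}$, there exists a map $\theta_{(p;n)}\colon\mathscr{S}_{d(n)+1}(p;n)\to\{\pm1\}$ such that for all $s\in\mathscr{S}_{d(n)+1}(p;n)$ we have $p_k(s;n)=0$ for $k\ge d(n)+1$ and $\frac{p_k(s;n)}{a_k}=\theta_{(p;n)}(s)\frac{p_{d(n)-k}(s;n)}{a_{d(n)-k}}$ for $0\le k\le d(n)$. Cayley continuants. $\mathrm{Cay}_0(x;y)=1$, and for $k\ge1$, $\mathrm{Cay}_k(x;y)$ is the determinant of the $k\times k$ tridiagonal matrix with all diagonal entries equal to $x$, entry $i$ in position $(i,i+1)$, and entry $y-i+1$ in position $(i+1,i)$ $(1\le i\le k-1)$. *)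

(* Defs.v *)
From HB Require Import structures.
From mathcomp Require Import all_boot all_order all_algebra.
From mathcomp Require Import polyXY.
From mathcomp Require Import classical_sets functions reals complex.

Set Implicit Arguments.
Unset Strict Implicit.
Unset Printing Implicit Defensive.

Import Order.TTheory GRing.Theory Num.Theory.
Local Open Scope classical_set_scope.
Local Open Scope ring_scope.

(* Bivariate polynomials p(x; y) over the complex numbers R[i] follow polyXY:  *)
(* x is 'X, y is 'Y, and p(s; t) is p.[s, t].                                 *)
Section PalindromicPair.
Variable R : realType.
Implicit Types (p : nat -> {poly {poly R[i]}}) (a : nat -> R[i]).

Definition zero_locus p (k n : nat) : set R[i] :=
  [set s | (p k).[s, n%:R] = 0].

(* The natural number m is d(n), when d(n) is one; no condition is imposed at  *)
(* the other n. A map theta from the zero locus to {1, -1} is encoded as a     *)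
(* function on R[i] whose values outside of the zero locus are irrelevant.     *)
Definition palindromic_pair p a (d : nat -> R) : Prop :=
  [/\ p 0%N = 1,
      forall k, a k != 0
    & forall n m : nat, d n = m%:R ->
        exists theta : R[i] -> R[i],
          set_fun (zero_locus p m.+1 n) [set 1; -1] theta /\
          forall s, zero_locus p m.+1 n s ->
            (forall k, (m.+1 <= k)%N -> (p k).[s, n%:R] = 0) /\
            (forall k, (k <= m)%N ->
               (p k).[s, n%:R] / a k =
               theta s * ((p (m - k)%N).[s, n%:R] / a (m - k)%N))].

(* With 0-based indices, the entries i in position (i, i+1) and y - i + 1 in   *)
(* position (i+1, i) are i.+1 at (i, i.+1) and y - j at (j.+1, j).             *)
Definition cayley_mx (k : nat) : 'M[{poly {poly R[i]}}]_k :=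
  \matrix_(i < k, j < k)
    (if i == j then 'X
     else if j == i.+1 :> nat then i.+1%:R
     else if i == j.+1 :> nat then 'Y - j%:R
     else 0).

Definition cayley (k : nat) : {poly {poly R[i]}} := \det (cayley_mx k).

Lemma cayley0 : cayley 0 = 1.
Proof. exact: det_mx00. Qed.

End PalindromicPair.

(* Main.v *)
Require Import Defs.
From mathcomp Require Import all_boot all_order all_algebra.
From mathcomp Require Import reals complex.
From mathcomp Require Import ring.
Local Open Scope ring_scope.

Import GRing.Theory Num.Theory.

(** Expanding the tridiagonal determinant along its last row and column
    ([det_tridiagonal]) gives the three-term recurrence
      c_(k+2) = x c_(k+1) - (k+1) (y - k) c_k
    for the Cayley continuants ([cayley_valueSS]).  Put y = n and
    q_k = c_k(s; n) / k!; then
      (k+1) q_(k+1) = s q_k - (n-k+1) q_(k-1).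
    The exchange of k with n - k swaps the weights k+1 and n-k+1, so the
    recurrence read downwards from n is the one read upwards from 0.  A zero s
    of c_(n+1) supplies the boundary value q_(n+1) = 0, the mirror image of
    q_(-1) = 0; hence both (q_(n-k)) and (q_n q_k) solve the same recurrence
    with the same initial data and q_(n-k) = q_n q_k ([normalized_mirror]).
    At k = n this reads 1 = q_n ^ 2, so the sign is theta(s) = q_n = q_n^-1.
    The continuants of index above n + 1 vanish because the coefficient of
    c_n in the recurrence for c_(n+2) is (n+1) (n - n) = 0
    ([cayley_value_eq0]). *)

(** The matrix is indexed by a function on natural numbers, so that its leading
    principal minors are the same expression at smaller sizes.  The minor
    obtained by deleting the last row and the last but one column has a last
    column with a single nonzero entry, at the bottom. *)
Lemma det_tridiagonal (A : comPzRingType) (F : nat -> nat -> A) (k : nat)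
    (F_low : forall i j, (j.+1 < i)%N -> F i j = 0)
    (F_up : forall i j, (i.+1 < j)%N -> F i j = 0) :
  \det (\matrix_(i < k.+2, j < k.+2) F i j) =
  F k.+1 k.+1 * \det (\matrix_(i < k.+1, j < k.+1) F i j)
  - F k.+1 k * F k k.+1 * \det (\matrix_(i < k, j < k) F i j).
Proof.
rewrite (expand_det_row _ ord_max) !big_ord_recr /= big1 ?add0r; last first.
  by move=> j _; rewrite mxE F_low ?mul0r //= ltnS.
rewrite !mxE /= addrC /cofactor; congr (_ + _).
  rewrite -signr_odd oddD addbb mul1r; congr (_ * \det _).
  by apply/matrixP=> i j; rewrite !mxE !lift_max.
rewrite -signr_odd oddD addNb addbb expr1 mulN1r mulrN -mulrA.
congr (- (_ * _)).
rewrite (expand_det_col _ ord_max) big_ord_recr /= big1 ?add0r; last first.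
  move=> i _; rewrite !mxE F_up ?mul0r //=.
  have ik := ltn_ord i.
  by rewrite /bump leqnn (leqNgt k.+1 i) ltnS (ltnW ik) !add0n add1n ltnS.
rewrite !mxE /= /bump leqnn ltnn add0n; congr (_ * _).
rewrite /cofactor -signr_odd oddD addbb mul1r; congr (\det _).
apply/matrixP=> i j; rewrite !mxE /= /bump.
have ik := ltn_ord i; have jk := ltn_ord j.
by rewrite !(leqNgt k) ik jk !add0n ltnNge (ltnW ik) jk.
Qed.

Section CayleyValues.
Variables (R : realType) (s y : R[i]).

Lemma cayley_value0 : (cayley R 0).[s, y] = 1.
Proof. by rewrite cayley0 !hornerE. Qed.

Lemma cayley_value1 : (cayley R 1).[s, y] = s.
Proof. by rewrite /cayley det_mx11 mxE eqxx !hornerE. Qed.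

Lemma cayley_valueSS (k : nat) :
  (cayley R k.+2).[s, y] =
  s * (cayley R k.+1).[s, y] - k.+1%:R * (y - k%:R) * (cayley R k).[s, y].
Proof.
pose F i j : {poly {poly R[i]}} :=
  if i == j then 'X else if j == i.+1 then i.+1%:R
  else if i == j.+1 then 'Y - j%:R else 0.
have cayleyE m : cayley R m = \det (\matrix_(i < m, j < m) F i j).
  by congr (\det _); apply/matrixP=> i j; rewrite !mxE.
have natE m : (m%:R : {poly {poly R[i]}}).[s, y] = m%:R.
  by rewrite !hornerMn !hornerE.
have F_low i j : (j.+1 < i)%N -> F i j = 0.
  move=> ji; rewrite /F (gtn_eqF ji) (gtn_eqF (ltnW ji)).
  by rewrite (ltn_eqF (leq_trans (ltnW ji) (leqnSn _))).
have F_up i j : (i.+1 < j)%N -> F i j = 0.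
  move=> ij; rewrite /F (gtn_eqF ij) (ltn_eqF (ltnW ij)).
  by rewrite (ltn_eqF (leq_trans (ltnW ij) (leqnSn _))).
rewrite !cayleyE (det_tridiagonal _ _ _ F_low F_up) /F !eqxx.
rewrite (gtn_eqF (ltnSn k)) (ltn_eqF (ltnSn k)).
rewrite (ltn_eqF (leqnSn k.+1)).
rewrite !hornerE !natE.
ring.
Qed.

End CayleyValues.

(** At y = n the coefficient of c_n in the recurrence for c_(n+2) vanishes, so
    two consecutive zeros start at n + 1 and propagate. *)
Lemma cayley_value_eq0 (R : realType) (s : R[i]) (n k : nat) :
  (cayley R n.+1).[s, n%:R] = 0 -> (n < k)%N -> (cayley R k).[s, n%:R] = 0.
Proof.
move=> cn0 /subnK <-; elim/ltn_ind: (k - _)%N => -[|[|j]] IH.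
- by rewrite add0n.
- by rewrite add1n cayley_valueSS cn0 subrr !mulr0 mul0r subrr.
- by rewrite !addSn cayley_valueSS -addSn !IH // !mulr0 subrr.
Qed.

Definition normalized_cayley (R : realType) (s : R[i]) (n k : nat) : R[i] :=
  (cayley R k).[s, n%:R] / k`!%:R.

Section Normalized.
Variables (R : realType) (s : R[i]) (n : nat).
Local Notation q := (normalized_cayley R s n).

Lemma normalized0 : q 0%N = 1.
Proof. by rewrite /normalized_cayley cayley_value0 divr1. Qed.

Lemma normalized1 : q 1%N = s.
Proof. by rewrite /normalized_cayley cayley_value1 divr1. Qed.

Lemma normalizedSS (k : nat) :
  k.+2%:R * q k.+2 = s * q k.+1 - (n%:R - k%:R) * q k.
Proof.
rewrite /normalized_cayley cayley_valueSS !factS !natrM.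
have k0 : k`!%:R != 0 :> R[i] by rewrite pnatr_eq0 -lt0n fact_gt0.
have k1 : k.+1%:R != 0 :> R[i] by rewrite pnatr_eq0.
have k2 : k.+2%:R != 0 :> R[i] by rewrite pnatr_eq0.
by field; rewrite k0 nat1r k1 -natrD k2.
Qed.

(** Induction on k with two consecutive indices: the recurrence at the mirrored
    index n - k - 2 is solved for its lowest term, whose coefficient k + 2 is
    the leading coefficient of the recurrence for q (k+2). *)
Lemma normalized_mirror (k : nat) :
  (cayley R n.+1).[s, n%:R] = 0 -> (k <= n)%N -> q (n - k)%N = q n * q k.
Proof.
move=> cn0; have qn0 : q n.+1 = 0 by rewrite /normalized_cayley cn0 mul0r.
elim/ltn_ind: k => -[|[|k]] IH kn.
- by rewrite subn0 normalized0 mulr1.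
- case: n kn qn0 normalized1 normalizedSS {cn0 IH} => // m _ qn0 q1 /(_ m).
  (* The boundary value q_(n+1) = 0 turns the last step of the recurrence
     into q_(n-1) = s q_n. *)
  rewrite qn0 mulr0 -natrB ?leqnSn // subSnn mul1r subn1 q1 /=.
  by move/eqP; rewrite eq_sym subr_eq0 mulrC => /eqP ->.
have k20 : k.+2%:R != 0 :> R[i] by rewrite pnatr_eq0.
have := normalizedSS (n - k.+2)%N.
have e1 : (n - k.+2).+1 = (n - k.+1)%N by rewrite -subSn.
have e2 : (n - k.+1).+1 = (n - k)%N by rewrite -subSn // ltnW.
rewrite e1 e2 (IH k) ?(IH k.+1) ?(ltnW (ltnW kn)) ?(ltnW kn) //.
rewrite !natrB ?(ltnW (ltnW kn)) //.
rewrite subKr => rec; apply: (mulfI k20).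
rewrite [RHS]mulrCA normalizedSS; move/eqP: rec; rewrite eq_sym subr_eq addrC -subr_eq => /eqP <-.
ring.
Qed.

End Normalized.

Theorem theorem1p28 (R : realType) :
  @palindromic_pair R (fun k => cayley R k) (fun k => (k`!)%:R) (fun n => n%:R).
Proof.
split=> [|k|n m /eqP].
- exact: cayley0.
- by rewrite pnatr_eq0 -lt0n fact_gt0.
rewrite eqr_nat => /eqP <- {m}; exists (fun s => normalized_cayley R s n n).
split=> [s cn0|s cn0].
  have := normalized_mirror _ _ _ _ cn0 (leqnn n).
  rewrite subnn normalized0 => /esym/eqP; rewrite -expr2 sqrf_eq1.
  by case/orP=> /eqP; [left|right].
split=> [k|k kn]; first exact: cayley_value_eq0.
(* The mirror identity is used at n - k, where its left side has index k. *)
by have := normalized_mirror _ _ _ _ cn0 (leq_subr k n); rewrite subKn.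
Qed.
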